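(* Let $\mathcal{P}$ denote the complex vector space of all polynomials in one variable $z$ with complex coefficients, and let $F:\mathcal{P}\to\mathbb{C}$ be a linear functional. Suppose $F(1)=1$ and there exists a positive real number $r$ such that $F((z-\alpha)^n)\neq 0$ for all integers $n\ge 1$ and all complex numbers $\alpha$ with $|\alpha|\ge r$. Then there exists a complex number $w$ with $|w|<r$ such that $F(p)=p(w)$ for all polynomials $p\in\mathcal{P}$.
   Context: No topology on $\mathcal{P}$ and no continuity of $F$ is assumed; ''linear'' means $\mathbb{C}$-linear. *)

(* Defs.v *)
From HB Require Import structures.
From mathcomp Require Import all_boot all_order all_algebra.
From mathcomp Require Import reals complex.

(* Main.v *)
Require Import Defs.
From HB Require Import structures.
From mathcomp Require Import all_boot all_order all_algebra.
From mathcomp Require Import reals complex.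
From mathcomp Require Import ring.
Set Implicit Arguments.
Unset Strict Implicit.
Unset Printing Implicit Defensive.
Import Order.TTheory GRing.Theory Num.Theory.
Local Open Scope ring_scope.
Local Open Scope complex_scope.

(** Write [m_k = F 'X^k].  For each [n], the polynomial
    [P_n(b) = F ((1 + b 'X) ^+ n) = \sum_k 'C(n, k) m_k b ^+ k]
    has no zero in the disc [`|b| <= r^-1], because for [b != 0] it equals
    [b ^+ n * F (('X + b^-1) ^+ n)].  Hence it factors as [\prod_a (1 + a 'X)]
    with at most [n] numbers [a], all of modulus at most [r].

    In terms of these [a], the coefficients of [P_n] are the elementary
    symmetric functions [e_k], and
    [e_1 e_k - (k + 1) e_(k+1)] is the sum of [a_j * \prod_(i in I) a_i] over
    the pairs [j \in I] with [#|I| = k]: only products with a repeated factor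
    survive, so its modulus is at most [k 'C(n, k) r ^+ k.+1].
    Substituting [e_k = 'C(n, k) m_k] and dividing by ['C(n, k)] gives
    [`|n (m_1 m_k - m_(k+1)) + k m_(k+1)| <= k r ^+ k.+1].
    The bound does not depend on [n], so [n] tending to infinity forces
    [m_(k+1) = m_1 m_k]: the functional is evaluation at [w = m_1].  Finally
    [F ('X - w) = 0] excludes [r <= `|w|].

    Analytically, [P_n(t / n)] tends to the entire function
    [\sum_k m_k t ^+ k / k`!], which is therefore zero-free of exponential type
    with value 1 at 0, hence equal to [exp (w t)]; the count of repeated factors
    replaces the theorems of Hurwitz and Hadamard used in that argument. *)

(** * Polynomials without zeros in a disc about the origin *)

Section ZeroFreeDisc.
Variable C : numClosedFieldType.
Implicit Types (a r : C) (s : seq C) (P : {poly C}).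

Lemma coef_mul1DaX a P k :
  ((1 + a *: 'X) * P)`_k = P`_k + a * (if k is j.+1 then P`_j else 0).
Proof. by rewrite mulrDl mul1r -scalerAl coefD coefZ coefXM; case: k. Qed.

Lemma coef1_prod_1DaX s : (\prod_(a <- s) (1 + a *: 'X))`_1 = \sum_(a <- s) a.
Proof.
have coef0 (t : seq C) : (\prod_(a <- t) (1 + a *: 'X))`_0 = 1.
  elim: t => [|a t IHt]; first by rewrite big_nil coef1.
  by rewrite big_cons coef_mul1DaX IHt mulr0 addr0.
elim: s => [|a s IHs]; first by rewrite !big_nil coef1.
by rewrite !big_cons coef_mul1DaX IHs coef0 mulr1 addrC.
Qed.

Lemma coef_prod_1DaX_le r s k : {in s, forall a, `|a| <= r} ->
  `|(\prod_(a <- s) (1 + a *: 'X))`_k| <= r ^+ k *+ 'C(size s, k).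
Proof.
elim: s k => [|a s IHs] k s_le.
  by rewrite big_nil coef1 normr_nat bin0n; case: k.
have a_le : `|a| <= r by apply: s_le; rewrite mem_head.
have {}IHs j := IHs j (fun b bs => s_le b (mem_behead (s := a :: s) bs)).
rewrite big_cons coef_mul1DaX /=; case: k => [|k].
  by rewrite mulr0 addr0 (le_trans (IHs 0)) ?bin0.
rewrite binS mulrnDr (le_trans (ler_normD _ _))// lerD// normrM.
by rewrite exprS -mulrnAr ler_pM.
Qed.

(** The polynomial below is the generating function of
    [e_1 e_k - (k + 1) e_(k+1)] and counts the products with one repeated
    factor.  Adjoining [a] to [s] multiplies it by [1 + a 'X] and adds
    [a ^+ 2 'X] times the product over [s], the terms in which [a] itself is
    repeated; the bound follows by Pascal's rule. *)
Lemma coef_repeated_factor_le r s k : {in s, forall a, `|a| <= r} ->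
  let P := \prod_(a <- s) (1 + a *: 'X) in
  `|((\sum_(a <- s) a) *: P - P^`())`_k| <= r ^+ k.+1 *+ (k * 'C(size s, k)).
Proof.
elim: s k => [|a s IHs] k s_le /=.
  rewrite !big_nil scale0r derivC subr0 coef0 normr0 bin0n.
  by case: k => [|k]; rewrite ?muln0 mulr0n.
have a_le : `|a| <= r by apply: s_le; rewrite mem_head.
have s'_le : {in s, forall b, `|b| <= r}.
  by move=> b bs; apply: s_le; rewrite in_cons bs orbT.
have {}IHs j := IHs j s'_le; have P_le j := coef_prod_1DaX_le j s'_le.
rewrite !big_cons; move: IHs P_le => /=.
set P := \prod_(b <- s) _; set D := _ - _ => D_le P_le.
have -> : (a + \sum_(b <- s) b) *: ((1 + a *: 'X) * P)
          - ((1 + a *: 'X) * P)^`() = (1 + a *: 'X) * D + a ^+ 2 *: ('X * P).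
  by rewrite /D derivM derivD derivZ derivX derivC -!mul_polyC; ring.
rewrite coefD coef_mul1DaX coefZ coefXM; case: k => [|k].
  by rewrite !mulr0 !addr0; exact: (le_trans (D_le 0)).
have -> : (k.+1 * 'C((size s).+1, k.+1) =
           k.+1 * 'C(size s, k.+1) + k * 'C(size s, k) + 'C(size s, k))%N.
  by rewrite binS mulnDr -addnA -mulSnr.
rewrite 2!mulrnDr (le_trans (ler_normD _ _))// lerD//.
  rewrite (le_trans (ler_normD _ _))// lerD// normrM.
  by rewrite exprS -mulrnAr ler_pM.
have -> : r ^+ k.+2 = r ^+ 2 * r ^+ k by rewrite -exprD.
rewrite normrM normrX -mulrnAr ler_pM ?exprn_ge0//.
by rewrite lerXn2r ?nnegrE// (le_trans _ a_le).
Qed.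

Lemma zero_free_disc_factorization r P : 0 < r -> P.[0] = 1 ->
    (forall b, `|b| <= r^-1 -> P.[b] != 0) ->
  exists2 s, {in s, forall a, `|a| <= r} &
    P = \prod_(a <- s) (1 + a *: 'X) /\ (size s).+1 = size P.
Proof.
move=> r_gt0 P0 P_neq0.
have Pn0 : P != 0 by apply: contra_eq_neq P0 => ->; rewrite horner0 eq_sym oner_neq0.
have [t Pt] := closed_field_poly_normal P.
have lc_neq0 : lead_coef P != 0 by rewrite lead_coef_eq0.
have t_gt b : b \in t -> r^-1 < `|b|.
  move=> bt; rewrite real_ltNge ?ger0_real ?invr_ge0 ?(ltW r_gt0)//.
  apply/negP => /P_neq0/negP; apply; rewrite -/(root P b) Pt.
  by rewrite rootZ// root_prod_XsubC.
have t_neq0 b : b \in t -> b != 0.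
  by move=> /t_gt b_gt; rewrite -normr_gt0 (lt_trans _ b_gt)// invr_gt0.
exists [seq - b^-1 | b <- t].
  move=> _ /mapP[b bt ->]; rewrite normrN normfV -[leRHS]invrK.
  by rewrite lef_pV2 ?posrE ?invr_gt0// ?normr_gt0 ?t_neq0// ltW ?t_gt.
split; last first.
  by rewrite size_map Pt size_scale// size_prod_XsubC.
(* Each factor is normalised by its value at 0; the constants cancel since
   P.[0] = 1. *)
have prodE : \prod_(b <- t) ('X - b%:P) =
    (\prod_(b <- t) - b) *: \prod_(b <- t) (1 + (- b^-1) *: 'X).
  rewrite -scaler_prod; apply: eq_big_seq => b /t_neq0 b_neq0.
  by rewrite scalerDr scalerA mulrNN divff// scale1r addrC alg_polyC polyCN.
have c1 : lead_coef P * \prod_(b <- t) - b = 1.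
  rewrite -[RHS]P0 [in RHS]Pt hornerZ horner_prod; congr (_ * _).
  by apply: eq_bigr => b _; rewrite !hornerE.
by rewrite big_map [LHS]Pt prodE scalerA c1 scale1r.
Qed.

Lemma zero_free_disc_coef_le r P n k : 0 < r -> P.[0] = 1 ->
    (forall b, `|b| <= r^-1 -> P.[b] != 0) -> (size P <= n.+1)%N ->
  `|P`_1 * P`_k - P`_k.+1 *+ k.+1| <= r ^+ k.+1 *+ (k * 'C(n, k)).
Proof.
move=> r_gt0 P0 P_neq0 sP.
have [s s_le [PE sE]] := zero_free_disc_factorization r_gt0 P0 P_neq0.
have := coef_repeated_factor_le k s_le; rewrite /= -coef1_prod_1DaX -PE.
rewrite coefB coefZ coef_deriv => /le_trans; apply.
rewrite -sE ltnS in sP.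
by rewrite ler_wpMn2l ?exprn_ge0 ?(ltW r_gt0)// leq_mul2l leq_bin2l ?orbT.
Qed.

End ZeroFreeDisc.

(** * Moments of a functional *)

Section Moments.
Variables (C : numClosedFieldType) (F : {scalar {poly C}}).

Definition moment_poly n : {poly C} :=
  \poly_(k < n.+1) (F 'X^k *+ 'C(n, k)).

Lemma coef_moment_poly n k : (moment_poly n)`_k = F 'X^k *+ 'C(n, k).
Proof. by rewrite coef_poly; case: ltnP => // kn; rewrite bin_small. Qed.

Lemma horner_moment_poly n b : (moment_poly n).[b] = F ((1 + b *: 'X) ^+ n).
Proof.
rewrite horner_poly exprDn linear_sum; apply: eq_bigr => k _ /=.
by rewrite expr1n mul1r exprZn linearMn linearZ /= mulrnAl mulrC.
Qed.

(** For [b != 0], [1 + b 'X] is [b] times ['X - (- b^-1)]. *)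
Lemma moment_poly_neq0 r n b : 0 < r -> F 1 = 1 ->
    (forall a, r <= `|a| -> F (('X - a%:P) ^+ n) != 0) ->
  `|b| <= r^-1 -> (moment_poly n).[b] != 0.
Proof.
move=> r_gt0 F1 F_neq0 b_le; rewrite horner_moment_poly.
have [->|b_neq0] := eqVneq b 0.
  by rewrite scale0r addr0 expr1n F1 oner_neq0.
have -> : 1 + b *: 'X = b *: ('X - (- b^-1)%:P).
  by rewrite scalerBr polyCN scalerN opprK scale_polyC divff// addrC.
rewrite exprZn linearZ mulf_neq0 ?expf_neq0 ?F_neq0//.
by rewrite normrN normfV -[r]invrK lef_pV2 ?posrE ?invr_gt0 ?normr_gt0.
Qed.

(** The coefficient estimate for [moment_poly n], divided by ['C(n, k)] via
    [k.+1 * 'C(n, k.+1) = (n - k) * 'C(n, k)]; the right-hand side no longer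
    depends on [n]. *)
Lemma moment_defect_le r n k : 0 < r -> F 1 = 1 ->
    (forall a, r <= `|a| -> F (('X - a%:P) ^+ n) != 0) -> (k <= n)%N ->
  `|F 'X * F 'X^k - F 'X^(k.+1)| *+ n <= (r ^+ k.+1 + `|F 'X^(k.+1)|) *+ k.
Proof.
move=> r_gt0 F1 F_neq0 kn.
have P0 : (moment_poly n).[0] = 1.
  by rewrite horner_moment_poly scale0r addr0 expr1n.
have := zero_free_disc_coef_le k r_gt0 P0
  (fun b => moment_poly_neq0 r_gt0 F1 F_neq0) (size_poly _ _).
rewrite !coef_moment_poly bin1 -mulrnA mulnC mul_bin_left.
set m := F 'X^k; set m' := F 'X^(k.+1); rewrite expr1.
have -> : F 'X *+ n * (m *+ 'C(n, k)) - m' *+ ((n - k) * 'C(n, k)) =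
    ((F 'X * m - m') *+ n + m' *+ k) *+ 'C(n, k).
  by rewrite mulrnA mulrnAr mulrnAl -mulrnBl mulrnBr// opprB addrA
    [(_ - _) *+ n]mulrnBl addrAC.
rewrite normrMn mulrnA ler_pMn2r ?bin_gt0// => le_k.
rewrite -normrMn -[X in `|X|](addrK (m' *+ k)) [leRHS]mulrnDl.
by rewrite (le_trans (ler_normB _ _))// [X in _ + X]normrMn lerD2r.
Qed.

Lemma multiplicative_moments_horner : F 1 = 1 ->
    (forall k, F 'X^(k.+1) = F 'X * F 'X^k) ->
  forall p, F p = p.[F 'X].
Proof.
move=> F1 FS p; have FX k : F 'X^k = F 'X ^+ k.
  by elim: k => [|k IHk]; rewrite ?expr0// FS IHk exprS.
rewrite -[in LHS](coefK p) poly_def linear_sum horner_coef.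
by apply: eq_bigr => k _; rewrite linearZ /= FX.
Qed.

End Moments.

(** * The archimedean step *)

(** [R[i]] is only partially ordered, so the archimedean property of [R] is
    applied to the real part of the quotient of [B] by the norm. *)
Lemma complex_norm_bounded_multiples_eq0 (R : realType) (d B : R[i]) (k : nat) :
  (forall n, (k <= n)%N -> `|d| *+ n <= B) -> d = 0.
Proof.
move=> d_le; apply/eqP; apply: contraT; rewrite -normr_gt0 => d_gt0.
pose N := (Num.truncn (complex.Re (B / `|d|))).+1.
have := d_le (maxn k N) (leq_maxl _ _).
rewrite -mulr_natl -ler_pdivlMr// => le_B.
have : (N%:R : R[i]) <= B / `|d|.
  by rewrite (le_trans _ le_B)// ler_nat leq_maxr.
rewrite -(rmorph_nat (real_complex R)) lecE => /andP[_] /=.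
by rewrite leNgt truncnS_gt.
Qed.

Theorem theoremA (R : realType) (F : {scalar {poly R[i]}}) (r : R)
  (F1 : F 1 = 1) (r_gt0 : 0 < r)
  (F_neq0 : forall (n : nat) (alpha : R[i]),
     (1 <= n)%N -> r%:C <= `|alpha| -> F (('X - alpha%:P) ^+ n) <> 0) :
  exists w : R[i], `|w| < r%:C /\ forall p : {poly R[i]}, F p = p.[w].
Proof.
have {}F_neq0 n alpha (n_gt0 : (1 <= n)%N) (le_alpha : r%:C <= `|alpha|) :
    F (('X - alpha%:P) ^+ n) != 0 by apply/eqP/F_neq0.
have rC_gt0 : 0 < r%:C by rewrite ltcR.
exists (F 'X); split.
  rewrite real_ltNge ?ger0_real ?(ltW rC_gt0)//; apply/negP => /(F_neq0 1 _ isT).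
  by rewrite expr1 linearB /= -[(F 'X)%:P]mulr1 mul_polyC linearZ /= F1 mulr1
    subrr eqxx.
apply: multiplicative_moments_horner => // k; apply/esym/eqP.
rewrite -subr_eq0; apply/eqP.
(* k.+1 keeps n positive, as F_neq0 demands. *)
apply: (complex_norm_bounded_multiples_eq0 (k := k.+1)) => n kn.
by apply: (moment_defect_le rC_gt0 F1 (n := n)) (ltnW kn) => a;
  apply: F_neq0; apply: leq_trans kn.
Qed.
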